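(* Let $0\le r\le n-1$ and let $G(\mathbf{S})=(G_{r+1}(\mathbf{S}),\dots,G_n(\mathbf{S}))$ be a column vector with entries in $R[\mathbf{x}][\mathbf{S}]$, $\mathbf{S}=(S_{r+1},\dots,S_n)$. Suppose that $\alpha\in(\mathbb{R}_{>0})^n$, $b>0$, $c>0$, $\beta,\gamma\in\mathbb{R}^n$ and $z\in R\langle\mathbf{x}\rangle^{n-r}$ are such that (1) $z$ has entries in $W(\alpha,\beta)\cap V(b)$; (2) each $G_j(z)$ is in $W(\alpha,\gamma)\cap V(c)$; (3) $\mathrm{Jac}_G(z)$ has entries in $W(\alpha,0)$ and determinant in $W(\alpha,0)^*$; (4) $\alpha^{-1}\cdot\gamma\le\alpha^{-1}\cdot\beta$. Let $\varepsilon=-\mathrm{Jac}_G(z)^{-1}G(z)$ and $z'=z+\varepsilon$. Then (1) through (4) hold for $z'$ instead of $z$ if we replace $b$ with $b'=\min\{b,c\}$, $c$ with $c'=2c$, $\alpha$ with $\alpha'=\alpha+\lambda\alpha$, $\beta$ with $\beta'$, and $\gamma$ with $\gamma'$, where $\lambda,\beta',\gamma'$ are determined as follows. Write each $G_j(\mathbf{S})=\sum_{l=0}^N\sum_{|J|=l}G_{j,J}(\mathbf{x})\mathbf{S}^J$ for some $N\ge2$, and assume that each $G_{r+i,J}(\mathbf{x})$ with $|J|\ge2$ is in $W(\alpha,\delta_{r+i,J})$ for some $\delta_{r+i,J}\in\mathbb{R}^n$. For $j=1,\dots,n-r$ let $J^{(j)}$ be obtained from $J$ by subtracting $1$ in its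 $j$-th position. Then $$\lambda=\max_{\substack{i=1,\dots,n-r\\ j=1,\dots,n-r}}\ \max{}^{+}_{\substack{|J|=2,\dots,N\\ 0<K\le J^{(j)}}}\left\{\alpha^{-1}\cdot\frac{\delta_{r+i,J}+(|J|-|K|-1)\beta+|K|\gamma}{(|J|-|K|-1)b+|K|c}\right\},$$ $\beta'$ is chosen such that $\alpha^{-1}\cdot\beta'=\alpha^{-1}\cdot\beta-\lambda b'$, and $\gamma'$ is chosen such that $\alpha^{-1}\cdot\gamma'$ equals $$\max_{\substack{i=1,\dots,n-r,\ |J|=2,\dots,N\\ 0\le K\le J,\ |K|\ge2}}\Bigl\{\alpha^{-1}\cdot\bigl(\delta_{r+i,J}+(|J|-|K|)\beta+|K|\gamma\bigr)-\lambda\bigl((|J|-|K|)b+|K|c\bigr)\Bigr\}.$$ Moreover, if $b'=b$ then further Newton iteration (repeating this step with the primed data) does not change $\alpha'$, $\beta'$ and $b'$.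
   Context: $R$ is the valuation ring of a finite extension $K$ of $\mathbb{Q}_p$, with uniformiser $\pi$ and valuation $v$ normalised by $v(p)=1$. $R\langle\mathbf{x}\rangle=R\langle x_1,\dots,x_n\rangle$ is the ring of power series over $R$ whose coefficients tend to $0$. For $\alpha=(\alpha_1,\dots,\alpha_n)\in(\mathbb{R}_{>0})^n$ put $\alpha^{-1}=(\alpha_1^{-1},\dots,\alpha_n^{-1})$; the dot denotes the standard inner product on $\mathbb{R}^n$. For $\beta\in\mathbb{R}^n$, $$W(\alpha,\beta)=\Bigl\{\sum_{D\ge0}a_D\mathbf{x}^D\in R\langle\mathbf{x}\rangle: v(a_D)\ge\alpha^{-1}\cdot(D-\beta)\text{ for all }D\Bigr\},$$ and for $c\ge0$, $V(c)=\{\sum_{D\ge 0} a_D\mathbf{x}^D\in R\langle\mathbf{x}\rangle: v(a_D)\ge c\text{ for all }D\}$. $W(\alpha,0)$ is a ring and $W(\alpha,0)^*$ its unit group. Multi-index notation is used; $J,K\in\mathbb{Z}_{\ge 0}^{n-r}$, $|J|$ is the sum of the entries, $K\le J$ is entrywise, $0<K$ means $0\le K\ne0$. $\max^+$ of a set of reals is the maximum of that set together with $0$. $\mathrm{Jac}_G$ is the Jacobian matrix of $G$ with respect to $\mathbf{S}$. In a further step the same $\delta_{r+i,J}$ are used (note $W(\alpha,\delta)\subseteq W(\alpha',\delta)$ for $\alpha'=(1+\lambda)\alpha$, $\lambda\ge0$); $\beta'$ matters only through $\alpha^{-1}\cdot\beta'$. *)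

(* Defs.v *)
From HB Require Import structures.
From mathcomp Require Import all_boot all_order all_algebra all_field.
(* mpoly must be imported before constructive_ereal: the opposite order makes
   their notations clash. *)
From mathcomp Require Import mpoly.
From mathcomp Require Import boolp classical_sets reals constructive_ereal.

Set Implicit Arguments.
Unset Strict Implicit.
Unset Printing Implicit Defensive.

Import Order.TTheory GRing.Theory Num.Theory.

Local Open Scope ring_scope.

Record valuation (RR : realType) (F : fieldType) := Valuation {
  val_fun :> F -> \bar RR;
  val_ninfty : forall x, val_fun x != -oo%E;
  val_eq0 : forall x, (val_fun x == +oo%E) = (x == 0);
  valM : forall x y, val_fun (x * y) = (val_fun x + val_fun y)%E;
  valD : forall x y,
    (Order.min (val_fun x) (val_fun y) <= val_fun (x + y)%R)%E }.

Definition padic_val_rat (RR : realType) (p : nat) (x : rat) : \bar RR :=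
  if x == 0 then +oo%E
  else ((logn p `|numq x|%N)%:R - (logn p `|denq x|%N)%:R)%R%:E.

(* [Qp] with [vp] is the completion of the rationals for the p-adic valuation;
   this determines the pair up to a unique isomorphism. *)
Record is_padic_field (RR : realType) (p : nat) (Qp : fieldType)
    (vp : valuation RR Qp) : Prop := IsPadicField {
  padic_extends_rat : forall x : rat, vp (ratr x) = padic_val_rat RR p x;
  padic_rat_dense : forall (x : Qp) (M : RR),
    exists q : rat, (M%:E <= vp (x - ratr q)%R)%E;
  padic_complete : forall u : nat -> Qp,
    (forall M : RR, exists N, forall i j, (N <= i)%N -> (N <= j)%N ->
       (M%:E <= vp (u i - u j)%R)%E) ->
    exists l, forall M : RR, exists N, forall i, (N <= i)%N ->
       (M%:E <= vp (u i - l)%R)%E }.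

Section ValuationRing.
Context (RR : realType) (F : fieldType) (v : valuation RR F).

Lemma val0 : v 0 = +oo%E.
Proof. by apply/eqP; rewrite val_eq0. Qed.

Lemma val_fin (x : F) : x != 0 -> exists r : RR, v x = r%:E.
Proof.
move=> x0; case vx : (v x) => [r||]; first by exists r.
- by move: x0; rewrite -(val_eq0 v) vx eqxx.
- by have := val_ninfty v x; rewrite vx eqxx.
Qed.

Lemma val1 : v 1 = 0%E.
Proof.
have [r vr] := val_fin (oner_neq0 F).
have := valM v 1 1; rewrite mulr1 vr -EFinD => -[rr].
by congr (_%:E); apply: (addrI r); rewrite addr0.
Qed.

Lemma valN1 : v (-1) = 0%E.
Proof.
have n0 : (-1 : F) != 0 by rewrite oppr_eq0 oner_neq0.
have [r vr] := val_fin n0.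
have := valM v (-1) (-1); rewrite mulrNN mulr1 val1 vr -EFinD => -[/esym/eqP].
by rewrite -mulr2n mulrn_eq0 /= => /eqP ->.
Qed.

Lemma valN (x : F) : v (- x) = v x.
Proof. by rewrite -mulN1r valM valN1 add0e. Qed.

Definition valring_pred : {pred F} := fun x => (0 <= v x)%E.

Lemma valring_subring : subring_closed valring_pred.
Proof.
split=> [|x y|x y]; rewrite !unfold_in.
- by rewrite val1.
- move=> x0 y0; apply: le_trans (valD v x (- y)).
  by rewrite le_min x0 valN.
- by move=> x0 y0; rewrite valM adde_ge0.
Qed.

HB.instance Definition _ :=
  GRing.isSubringClosed.Build F valring_pred valring_subring.

Record valring := Valring {
  valring_val :> F;
  valring_valP : valring_val \in valring_pred }.

HB.instance Definition _ := [isSub for valring_val].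
HB.instance Definition _ := [Choice of valring by <:].
HB.instance Definition _ := [SubChoice_isSubComNzRing of valring by <:].

End ValuationRing.

Definition mpseries (n : nat) (A : Type) : Type := 'X_{1..n} -> A.

Section PowerSeries.
Context (n : nat) (A : comNzRingType).
Local Notation S := (mpseries n A).
Implicit Types (a b c : S) (m : 'X_{1..n}).

HB.instance Definition _ := gen_eqMixin S.
HB.instance Definition _ := gen_choiceMixin S.

Definition mps_zero : S := fun=> 0.
Definition mps_opp a : S := fun m => - a m.
Definition mps_add a b : S := fun m => a m + b m.

Lemma mps_addA : associative mps_add.
Proof. by move=> a b c; apply: funext => m; exact: addrA. Qed.
Lemma mps_addC : commutative mps_add.
Proof. by move=> a b; apply: funext => m; exact: addrC. Qed.
Lemma mps_add0 : left_id mps_zero mps_add.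
Proof. by move=> a; apply: funext => m; exact: add0r. Qed.
Lemma mps_addN : left_inverse mps_zero mps_opp mps_add.
Proof. by move=> a; apply: funext => m; exact: addNr. Qed.

HB.instance Definition _ :=
  GRing.isZmodule.Build S mps_addA mps_addC mps_add0 mps_addN.

Definition mps_one : S := fun m => (m == 0%MM)%:R.
Definition mps_mul a b : S := fun m =>
  \sum_(k : 'X_{1..n < (mdeg m).+1} | (k <= m)%MM) a k * b (m - k)%MM.

(* The ring laws are transported from polynomials by truncation. *)
Definition mps_trunc d a : {mpoly A[n]} :=
  \sum_(k : 'X_{1..n < d}) a k *: 'X_[k].

Lemma mcoeff_trunc d a m : (mdeg m < d)%N -> (mps_trunc d a)@_m = a m.
Proof.
move=> md; rewrite /mps_trunc raddf_sum /= (bigD1 (BMultinom md)) //=.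
rewrite mcoeffZ mcoeffX eqxx mulr1 big1 ?addr0 // => k kn.
by rewrite mcoeffZ mcoeffX -[_ == m]/(k == BMultinom md) (negbTE kn) mulr0.
Qed.

Lemma mcoeffMlin (p q : {mpoly A[n]}) m : (p * q)@_m =
  \sum_(k : 'X_{1..n < (mdeg m).+1} | (k <= m)%MM) p@_k * q@_(m - k).
Proof. exact: (mcoeff_poly_mul_lin p q (ltnSn (mdeg m))). Qed.

Lemma mps_mulE d a b m : (mdeg m < d)%N ->
  mps_mul a b m = (mps_trunc d a * mps_trunc d b)@_m.
Proof.
move=> md; rewrite mcoeffMlin /mps_mul.
apply: eq_bigr => k _; rewrite !mcoeff_trunc //.
  exact: leq_ltn_trans (mdegB _ _) md.
by apply: leq_trans md; exact: bmdeg.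
Qed.

Lemma mcoeffM_eq (p p' q q' : {mpoly A[n]}) m :
  (forall k, (mdeg k <= mdeg m)%N -> p@_k = p'@_k) ->
  (forall k, (mdeg k <= mdeg m)%N -> q@_k = q'@_k) ->
  (p * q)@_m = (p' * q')@_m.
Proof.
move=> pp qq; rewrite !mcoeffMlin.
apply: eq_bigr => k _; rewrite pp ?qq ?mdegB //.
by rewrite -ltnS; exact: bmdeg.
Qed.

Lemma mps_mulA : associative mps_mul.
Proof.
move=> a b c; apply: funext => m.
have dm := ltnSn (mdeg m).
rewrite !(mps_mulE _ _ dm).
transitivity ((mps_trunc (mdeg m).+1 a * mps_trunc (mdeg m).+1 b *
               mps_trunc (mdeg m).+1 c)@_m).
  rewrite -mulrA; apply: mcoeffM_eq => // k km.
  by rewrite mcoeff_trunc // (mps_mulE (d := (mdeg m).+1)).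
apply: mcoeffM_eq => // k km.
by rewrite mcoeff_trunc // (mps_mulE (d := (mdeg m).+1)).
Qed.

Lemma mps_mulC : commutative mps_mul.
Proof.
by move=> a b; apply: funext => m; rewrite !(mps_mulE _ _ (ltnSn _)) mulrC.
Qed.

Lemma mps_mul1 : left_id mps_one mps_mul.
Proof.
move=> a; apply: funext => m; have dm := ltnSn (mdeg m).
rewrite (mps_mulE _ _ dm) -[RHS](mcoeff_trunc a dm) -[in RHS](mul1r (mps_trunc _ a)).
apply: mcoeffM_eq => // k km.
by rewrite mcoeff_trunc // mcoeff1.
Qed.

Lemma mps_mulD : left_distributive mps_mul mps_add.
Proof.
move=> a b c; apply: funext => m; rewrite /mps_mul /mps_add -big_split /=.
by apply: eq_bigr => k _; rewrite mulrDl.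
Qed.

Lemma mps_one_neq0 : mps_one != mps_zero.
Proof.
apply/eqP => /(congr1 (fun f : S => f 0%MM)); rewrite /mps_one /mps_zero eqxx.
by move/eqP; rewrite oner_eq0.
Qed.

HB.instance Definition _ := GRing.Zmodule_isComNzRing.Build S
  mps_mulA mps_mulC mps_mul1 mps_mulD mps_one_neq0.

End PowerSeries.

Section Tate.
Context (RR : realType) (F : fieldType) (v : valuation RR F) (n : nat).
Local Notation R := (valring v).
Local Notation S := (mpseries n R).

Definition restricted : {pred S} := fun a =>
  `[< forall M : RR, exists d, forall m, (d <= mdeg m)%N ->
        (M%:E <= v (\val (a m)))%E >].

Lemma restricted_subring : subring_closed restricted.
Proof.
split=> [|a b|a b].
- apply/asboolP => M; exists 1%N => m m1.
  have -> : (1 : S) m = 0.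
    by rewrite [LHS]/(mps_one R m) /mps_one -mdeg_eq0 -leqn0 leqNgt m1.
  by rewrite rmorph0 val0 leey.
- move=> /asboolP ha /asboolP hb; apply/asboolP => M.
  have [d1 h1] := ha M; have [d2 h2] := hb M.
  exists (maxn d1 d2) => m; rewrite geq_max => /andP[m1 m2].
  have -> : (a - b) m = a m - b m by [].
  rewrite rmorphB; apply: le_trans (valD _ _ _).
  by rewrite le_min h1 // valN h2.
move=> /asboolP ha /asboolP hb; apply/asboolP => M.
have [d1 h1] := ha M; have [d2 h2] := hb M.
exists (d1 + d2)%N => m mdm.
have -> : (a * b) m = mps_mul a b m by [].
rewrite /mps_mul rmorph_sum /=.
elim/big_ind: _ => [|x y hx hy|k km].
- by rewrite val0 leey.
- by apply: le_trans (valD _ _ _); rewrite le_min hx hy.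
have posv (x : R) : (0 <= v (\val x))%E by exact: valP x.
rewrite -[v _]/(v (\val (a k) * \val (b (m - k)%MM))) valM; have [kd|kd] := leqP d1 (mdeg k).
  by rewrite -[M%:E]adde0; apply: leeD => //; exact: h1.
rewrite -[M%:E]add0e; apply: leeD => //; apply: h2.
have mE : mdeg m = (mdeg (m - k)%MM + mdeg k)%N by rewrite -mdegD submK.
by rewrite -(leq_add2r (mdeg k)) -mE (leq_trans _ mdm) // addnC leq_add2r ltnW.
Qed.

HB.instance Definition _ :=
  GRing.isSubringClosed.Build S restricted restricted_subring.

Record tate := Tate {
  tate_series :> S;
  tate_seriesP : tate_series \in restricted }.

HB.instance Definition _ := [isSub for tate_series].
HB.instance Definition _ := [Choice of tate by <:].
HB.instance Definition _ := [SubChoice_isSubComNzRing of tate by <:].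

(* The inverse is the usual one on units, and the identity elsewhere. *)
Definition tate_unit : {pred tate} := fun a => `[< exists b, b * a = 1 >].
Definition tate_inv (a : tate) : tate := xget a [set b | b * a = 1].

Lemma tate_mulVr : {in tate_unit, left_inverse 1 tate_inv *%R}.
Proof.
move=> a /asboolP[b ba]; rewrite /tate_inv.
by case: xgetP => [c _ //|/(_ b)].
Qed.

Lemma tate_unitPl (a b : tate) : b * a = 1 -> tate_unit a.
Proof. by move=> ba; apply/asboolP; exists b. Qed.

Lemma tate_inv_out : {in [predC tate_unit], tate_inv =1 id}.
Proof.
move=> a; rewrite inE => /asboolPn na; rewrite /tate_inv.
by case: xgetP => [c _ ca|//]; case: na; exists c.
Qed.

HB.instance Definition _ := GRing.ComNzRing_hasMulInverse.Build tate
  tate_mulVr tate_unitPl tate_inv_out.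

Lemma restricted_poly (P : {mpoly R[n]}) :
  ((fun m => P@_m) : S) \in restricted.
Proof.
apply/asboolP => M; exists (msize P) => m Pm.
by rewrite memN_msupp_eq0 ?msize_mdeg_ge // rmorph0 val0 leey.
Qed.

Definition tate_of_poly (P : {mpoly R[n]}) : tate := Tate (restricted_poly P).

End Tate.

Section WV.
Context (RR : realType) (n : nat).

Definition dotp (x y : 'rV[RR]_n) : RR := \sum_(i < n) x 0 i * y 0 i.

Definition vinv (x : 'rV[RR]_n) : 'rV[RR]_n := \row_i (x 0 i)^-1.

Definition multi_vec (D : 'X_{1..n}) : 'rV[RR]_n := \row_i (D i)%:R.

Context (F : fieldType) (v : valuation RR F).

Definition W (alpha beta : 'rV[RR]_n) : set (tate v n) :=
  [set f | forall D, ((dotp (vinv alpha) (multi_vec D - beta)%R)%:E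
                        <= v (\val (tate_series f D)))%E].

Definition V (c : RR) : set (tate v n) :=
  [set f | forall D, (c%:E <= v (\val (tate_series f D)))%E].

Definition W_units (alpha : 'rV[RR]_n) : set (tate v n) :=
  [set f | W alpha 0 f /\ exists2 g, W alpha 0 g & f * g = 1].

End WV.

Arguments W {RR n F v} alpha beta.
Arguments V {RR n F v} c.
Arguments W_units {RR n F v} alpha.

(* [ S_(r+1), .., S_n ] are indexed by ['I_m] with [m = n - r], and so are the
   entries of [G]. *)
Section Newton.
Context (RR : realType) (F : fieldType) (v : valuation RR F) (n m : nat).
Local Notation R := (valring v).
Local Notation Tn := (tate v n).
Local Notation RxS := {mpoly {mpoly R[n]}[m]}.

Definition tate_eval (z : 'cV[Tn]_m) (P : RxS) : Tn :=
  mmap (@tate_of_poly RR F v n) (fun i => z i 0) P.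

Definition G_at (G : 'cV[RxS]_m) (z : 'cV[Tn]_m) : 'cV[Tn]_m :=
  map_mx (tate_eval z) G.

Definition Jac (G : 'cV[RxS]_m) : 'M[RxS]_m :=
  \matrix_(i, j) (G i 0)^`M(j).

Definition Jac_at (G : 'cV[RxS]_m) (z : 'cV[Tn]_m) : 'M[Tn]_m :=
  map_mx (tate_eval z) (Jac G).

Definition newton_eps (G : 'cV[RxS]_m) (z : 'cV[Tn]_m) : 'cV[Tn]_m :=
  - (invmx (Jac_at G z) *m G_at G z).

Record newton_data := NewtonData {
  nd_alpha : 'rV[RR]_n;
  nd_beta : 'rV[RR]_n;
  nd_gamma : 'rV[RR]_n;
  nd_b : RR;
  nd_c : RR }.

Definition newton_cond (G : 'cV[RxS]_m) (z : 'cV[Tn]_m) (d : newton_data) :=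
  let: NewtonData alpha beta gamma b c := d in
  [/\ forall i, (W alpha beta `&` V b)%classic (z i 0),
      forall i, (W alpha gamma `&` V c)%classic (G_at G z i 0),
      (forall i j, W alpha 0 (Jac_at G z i j)) /\
        W_units alpha (\det (Jac_at G z))
    & dotp (vinv alpha) gamma <= dotp (vinv alpha) beta].

Context (N : nat) (delta : 'I_m -> 'X_{1..m} -> 'rV[RR]_n).

(* When [J j = 0] the index [J^(j)] has a negative entry, so no [K >= 0]
   satisfies [K <= J^(j)]; since [J - U_(j)] is truncated, the condition
   [0 < J j] has to be explicit. *)
Definition newton_lambda (d : newton_data) : RR :=
  let: NewtonData alpha beta gamma b c := d in
  \big[Num.max/0]_(i < m) \big[Num.max/0]_(j < m)
  \big[Num.max/0]_(JK : 'X_{1..m < N.+1, N.+1} |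
        [&& (2 <= mdeg JK.1)%N, JK.2 != 0%MM :> 'X_{1..m},
            (0 < JK.1 j)%N & (JK.2 <= JK.1 - U_(j))%MM])
    let J : 'X_{1..m} := JK.1 in
    let lJ : RR := (mdeg JK.1)%:R in
    let lK : RR := (mdeg JK.2)%:R in
    dotp (vinv alpha)
         (delta i J + (lJ - lK - 1) *: beta + lK *: gamma)
      / ((lJ - lK - 1) * b + lK * c).

Definition newton_gamma_set (d : newton_data) : set RR :=
  let: NewtonData alpha beta gamma b c := d in
  [set t | exists i (J K : 'X_{1..m}),
     let lJ : RR := (mdeg J)%:R in
     let lK : RR := (mdeg K)%:R in
     [/\ (2 <= mdeg J <= N)%N, (K <= J)%MM, (2 <= mdeg K)%N
       & t = dotp (vinv alpha)
                  (delta i J + (lJ - lK) *: beta + lK *: gamma)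
             - newton_lambda d * ((lJ - lK) * b + lK * c)]]%classic.

Definition is_max (A : set RR) (t : RR) : Prop := A t /\ ubound A t.

Definition newton_step (d d' : newton_data) : Prop :=
  let: NewtonData alpha beta gamma b c := d in
  let: NewtonData alpha' beta' gamma' b' c' := d' in
  let lambda := newton_lambda d in
  [/\ alpha' = alpha + lambda *: alpha,
      dotp (vinv alpha) beta' = dotp (vinv alpha) beta - lambda * b',
      is_max (newton_gamma_set d) (dotp (vinv alpha) gamma'),
      b' = Num.min b c
    & c' = 2 * c].

End Newton.

(* Main.v *)
(* A coefficient satisfying [v >= wt - s] and [v >= t] also satisfies
   [(1 + lambda) v >= wt - (s - lambda t)].  So an element of W(alpha, .) that
   also lies in V(t) gets a better W-bound when alpha is stretched by
   [1 + lambda]; [lambda] is chosen so that all the correction terms of the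
   Jacobian land in W(alpha', 0).  The Taylor expansion is carried out in one
   auxiliary variable: the coefficient of [X^k] in [P(z + eps X)] is homogeneous
   of degree k in eps, so its bounds depend on a multi-index K only through
   |K| = k.  The new determinant is still a unit, as an element of W(alpha', 0)
   is a unit there as soon as its constant coefficient has valuation 0. *)
Require Import Defs.
From HB Require Import structures.
From mathcomp Require Import all_boot all_order all_algebra all_field.
From mathcomp Require Import mpoly.
From mathcomp Require Import boolp classical_sets reals constructive_ereal.
From mathcomp Require Import lra ring zify.

Set Implicit Arguments.
Unset Strict Implicit.
Unset Printing Implicit Defensive.

Import Order.TTheory GRing.Theory Num.Theory.

Local Open Scope ring_scope.

(** * Arithmetic of series bounded simultaneously by decay and by a constant *)

Section WV_theory.
Context (RR : realType) (F : fieldType) (v : valuation RR F) (n : nat).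
Local Notation R := (valring v).
Local Notation T := (tate v n).
Implicit Types (f g : T) (D : 'X_{1..n}) (alpha beta : 'rV[RR]_n).

Lemma tate_coefM f g D : tate_series (f * g) D =
  \sum_(k : 'X_{1..n < (mdeg D).+1} | (k <= D)%MM)
    tate_series f k * tate_series g (D - k)%MM.
Proof. by []. Qed.

Lemma tate_coef1 D : tate_series (1 : T) D = (D == 0%MM)%:R.
Proof. by []. Qed.

Lemma tate_coefD f g D :
  tate_series (f + g) D = tate_series f D + tate_series g D.
Proof. by []. Qed.

Lemma tate_coef0M f g :
  tate_series (f * g) 0%MM = tate_series f 0%MM * tate_series g 0%MM.
Proof.
rewrite tate_coefM.
have d0 : (mdeg (0%MM : 'X_{1..n}) < (mdeg (0%MM : 'X_{1..n})).+1)%N by [].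
rewrite (bigD1 (BMultinom d0)) ?lepm_refl //= big1 ?addr0; first by rewrite subm0.
move=> k /andP[k0 /eqP]; case; apply: val_inj => /=; apply/mnmP => i.
by move/mnm_lepP/(_ i): k0; rewrite mnm0E leqn0 => /eqP.
Qed.

Lemma tate_of_poly_is_additive : additive (@tate_of_poly RR F v n).
Proof.
move=> P Q; apply: val_inj; apply: funext => m /=; exact: mcoeffB.
Qed.

Lemma tate_of_poly_is_multiplicative : multiplicative (@tate_of_poly RR F v n).
Proof.
split=> [P Q|]; apply: val_inj; apply: funext => m /=; last exact: mcoeff1.
by rewrite mcoeffMlin.
Qed.

HB.instance Definition _ :=
  GRing.isAdditive.Build _ _ _ tate_of_poly_is_additive.
HB.instance Definition _ :=
  GRing.isMultiplicative.Build _ _ _ tate_of_poly_is_multiplicative.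

Lemma val_valring_ge0 (x : R) : (0 <= v (\val x))%E.
Proof. exact: valP x. Qed.

Lemma val_add_ge (e : \bar RR) (x y : R) :
  (e <= v (\val x))%E -> (e <= v (\val y))%E -> (e <= v (\val (x + y)%R))%E.
Proof.
move=> ex ey; apply: le_trans (Defs.valD v (\val x) (\val y)).
by rewrite le_min ex ey.
Qed.

Lemma val_sum_ge (e : \bar RR) (I : Type) (r : seq I) (P : pred I) (E : I -> R) :
  (forall i, P i -> (e <= v (\val (E i)))%E) ->
  (e <= v (\val (\sum_(i <- r | P i) E i)%R))%E.
Proof.
move=> le_e; elim/big_ind: _ => // [|x y ex ey].
  by rewrite [\val _](_ : _ = 0) // val0 leey.
by apply: le_trans (valD _ _ _); rewrite le_min ex ey.
Qed.

Lemma dotpD (x y z : 'rV[RR]_n) : dotp x (y + z) = dotp x y + dotp x z.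
Proof.
by rewrite /dotp -big_split; apply: eq_bigr => i _; rewrite mxE mulrDr.
Qed.

Lemma dotpZ (x y : 'rV[RR]_n) (a : RR) : dotp x (a *: y) = a * dotp x y.
Proof.
by rewrite /dotp mulr_sumr; apply: eq_bigr => i _; rewrite mxE mulrCA.
Qed.

Lemma dotpZl (x y : 'rV[RR]_n) (a : RR) : dotp (a *: x) y = a * dotp x y.
Proof.
by rewrite /dotp mulr_sumr; apply: eq_bigr => i _; rewrite mxE mulrA.
Qed.

Lemma dotpB (x y z : 'rV[RR]_n) : dotp x (y - z) = dotp x y - dotp x z.
Proof. by rewrite dotpD -scaleN1r dotpZ mulN1r. Qed.

Lemma dotp0 (x : 'rV[RR]_n) : dotp x 0 = 0.
Proof. by rewrite -(scale0r 0) dotpZ mul0r. Qed.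

Lemma vinvZ (a : RR) alpha : vinv (a *: alpha) = a^-1 *: vinv alpha.
Proof. by apply/rowP => i; rewrite !mxE invfM. Qed.

Definition wt alpha D : RR := dotp (vinv alpha) (multi_vec RR D).

Lemma wtD alpha D E : wt alpha (D + E)%MM = wt alpha D + wt alpha E.
Proof.
rewrite /wt -dotpD; congr dotp.
by apply/rowP => i; rewrite !mxE mnmDE natrD.
Qed.

Lemma wt0 alpha : wt alpha 0%MM = 0.
Proof. by apply: (addrI (wt alpha 0%MM)); rewrite -wtD add0m addr0. Qed.

(** Each 1/alpha_i is at least mu = 1/(1 + sum of the alpha_j); the summand 1 keeps mu positive when
    n = 0. Weight bounds thus force coefficients to tend to 0. *)
Lemma wt_ge_mdeg alpha : (forall i, 0 < alpha 0 i) ->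
  exists2 mu : RR, 0 < mu & forall D, mu * (mdeg D)%:R <= wt alpha D.
Proof.
move=> alpha0; exists (1 + \sum_i alpha 0 i)^-1 => [|D].
  by rewrite invr_gt0 ltr_pwDl ?sumr_ge0 // => i _; exact: ltW.
rewrite mdegE natr_sum mulr_sumr; apply: ler_sum => i _.
rewrite !mxE ler_wpM2r // lef_pV2 ?posrE //; last first.
  by rewrite ltr_pwDl ?sumr_ge0 // => j _; exact: ltW.
rewrite (bigD1 i) //= addrCA lerDl addr_ge0 ?sumr_ge0 // => j _; exact: ltW.
Qed.

(* The intersection of [W(alpha, beta)] and [V(t)], where [s = alpha^-1 . beta]. *)
Definition WV alpha (s t : RR) f : Prop := forall D,
  ((wt alpha D - s)%:E <= v (\val (tate_series f D)))%E /\
  (t%:E <= v (\val (tate_series f D)))%E.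

Lemma WVE alpha beta t f :
  (W alpha beta `&` V t)%classic f <-> WV alpha (dotp (vinv alpha) beta) t f.
Proof.
split=> [[Wf Vf] D|WVf]; first by split; [rewrite -dotpB; exact: Wf|exact: Vf].
by split=> D; have [Wf Vf] := WVf D; rewrite ?dotpB.
Qed.

Lemma W_WV alpha beta f : W alpha beta f <-> WV alpha (dotp (vinv alpha) beta) 0 f.
Proof.
rewrite -WVE; split=> [Wf|[]//]; split=> // D; exact: val_valring_ge0.
Qed.

Lemma WV_le alpha s t s' t' f : s <= s' -> t' <= t -> WV alpha s t f -> WV alpha s' t' f.
Proof.
move=> ss tt WVf D; have [Wf Vf] := WVf D; split.
  by apply: le_trans Wf; rewrite lee_fin lerB.
by apply: le_trans Vf; rewrite lee_fin.
Qed.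

Lemma WV0 alpha s t : WV alpha s t 0.
Proof. by move=> D; rewrite [\val _](_ : _ = 0) // val0 !leey. Qed.

Lemma WV1 alpha : WV alpha 0 0 1.
Proof.
move=> D; rewrite tate_coef1; have [->|_] := eqVneq D 0%MM.
  by rewrite wt0 subr0 [\val _](_ : _ = 1) // Defs.val1.
by rewrite [\val _](_ : _ = 0) // val0 !leey.
Qed.

Lemma WVN alpha s t f : WV alpha s t f -> WV alpha s t (- f).
Proof.
move=> WVf D; rewrite [\val _](_ : _ = - \val (tate_series f D)) // Defs.valN.
exact: WVf.
Qed.

Lemma WVD alpha s t f g : WV alpha s t f -> WV alpha s t g -> WV alpha s t (f + g).
Proof.
move=> WVf WVg D; have [? ?] := WVf D; have [? ?] := WVg D.
by split; apply: val_add_ge.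
Qed.

Lemma WV_sum alpha s t (I : Type) (r : seq I) (P : pred I) (E : I -> T) :
  (forall i, P i -> WV alpha s t (E i)) -> WV alpha s t (\sum_(i <- r | P i) E i).
Proof. by move=> WE; elim/big_ind: _ => //; [exact: WV0|exact: WVD]. Qed.

Lemma WVM alpha s t s' t' f g : WV alpha s t f -> WV alpha s' t' g ->
  WV alpha (s + s') (t + t') (f * g).
Proof.
move=> WVf WVg D; rewrite tate_coefM.
split; apply: val_sum_ge => k kD; have [? ?] := WVf k;
  have [? ?] := WVg (D - k)%MM; rewrite -[v _]/(v (_ * _)) Defs.valM.
  have -> : wt alpha D = wt alpha k + wt alpha (D - k)%MM by rewrite -wtD addmC submK.
  by rewrite opprD addrACA EFinD leeD.
by rewrite EFinD leeD.
Qed.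

Lemma WVMl alpha s t f g : WV alpha 0 0 f -> WV alpha s t g -> WV alpha s t (f * g).
Proof. by move=> Wf Wg; have := WVM Wf Wg; rewrite !add0r. Qed.

Lemma WV_sign alpha k : WV alpha 0 0 ((-1) ^+ k).
Proof.
rewrite -signr_odd; case: (odd k); rewrite ?expr1 ?expr0; last exact: WV1.
by apply: WVN; exact: WV1.
Qed.

Lemma WV_natr alpha k : WV alpha 0 0 k%:R.
Proof.
elim: k => [|k IHk]; first exact: WV0.
by rewrite -addn1 natrD; apply: WVD => //; exact: WV1.
Qed.

Lemma WV_det alpha k (A : 'M[T]_k) :
  (forall i j, WV alpha 0 0 (A i j)) -> WV alpha 0 0 (\det A).
Proof.
move=> WA; apply: WV_sum => s _; apply: WVMl; first exact: WV_sign.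
elim/big_ind: _ => // [|f g]; [exact: WV1|exact: WVMl].
Qed.

(** V(t) is an ideal for the product, so congruence modulo V(t) passes through the sums and products
    of the Leibniz formula. *)
Lemma det_V k (t : RR) (A B : 'M[T]_k) :
  (forall i j, V t (A i j - B i j)) -> V t (\det A - \det B).
Proof.
pose sim f g := V t (f - g).
have VM f g : V t f -> V t (g * f).
  move=> Vf D; rewrite tate_coefM; apply: val_sum_ge => j _.
  rewrite -[v _]/(v (_ * _)) Defs.valM -[t%:E]add0e leeD //; exact: val_valring_ge0.
have VD f g : V t f -> V t g -> V t (f + g).
  by move=> Vf Vg D; apply: val_add_ge; [exact: Vf|exact: Vg].
have V0 : V t (0 : T) by move=> D; rewrite [\val _](_ : _ = 0) // val0 leey.
have simD f g f' g' : sim f g -> sim f' g' -> sim (f + f') (g + g').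
  by rewrite /sim opprD addrACA; exact: VD.
have simM f g f' g' : sim f g -> sim f' g' -> sim (f * f') (g * g').
  move=> Vf Vg; rewrite /sim.
  have -> : f * f' - g * g' = f * (f' - g') + g' * (f - g) by ring.
  by apply: VD; apply: VM.
have sim_refl f : sim f f by rewrite /sim subrr.
move=> VAB; apply: (big_ind2 sim) => [||s _]; [exact: sim_refl|by move=> *; exact: simD|].
by apply: (simM) => //; apply: (big_ind2 sim) => // i _; exact: VAB.
Qed.

End WV_theory.

(** * Stretching alpha, and the units of W(alpha, 0) *)

Section Rescaling.
Context (RR : realType) (F : fieldType) (v : valuation RR F) (n : nat).
Local Notation R := (valring v).
Local Notation T := (tate v n).
Implicit Types (f g : T) (D : 'X_{1..n}) (alpha beta : 'rV[RR]_n).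

(* Trading the bound [t] for decay: [v >= wt D - s] and [v >= t] give
   [(1 + lambda) v >= wt D - (s - lambda t)]. *)
Lemma WV_rescale alpha (lambda s t s' : RR) f : 0 <= lambda ->
  s - lambda * t <= (1 + lambda) * s' ->
  WV alpha s t f -> WV ((1 + lambda) *: alpha) s' t f.
Proof.
move=> l0 ss' WVf D; have [Wf Vf] := WVf D; split=> //.
have l1 : 0 < 1 + lambda by rewrite ltr_pwDl.
rewrite /wt vinvZ dotpZl -/(wt alpha D).
(* The larger lower bound is used: here t, and in the other case t <= wt D - s absorbs the term
   lambda t. *)
case: (leP (wt alpha D - s) t) => [st|/ltW ts].
  apply: le_trans Vf; rewrite lee_fin lerBlDr mulrC ler_pdivrMr //; nra.
apply: le_trans Wf; rewrite lee_fin lerBlDr mulrC ler_pdivrMr //; nra.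
Qed.

Lemma restricted_decay alpha (a : mpseries n R) : (forall i, 0 < alpha 0 i) ->
  (forall D, ((wt alpha D)%:E <= v (\val (a D)))%E) -> a \in @restricted RR F v n.
Proof.
move=> /wt_ge_mdeg[mu mu0 mu_le] Wa; apply/asboolP => M.
exists (Num.truncn (Num.max 0 (M / mu))).+1 => D leD.
apply: le_trans (Wa D); rewrite lee_fin (le_trans _ (mu_le D)) //.
rewrite -ler_pdivrMl // mulrC; apply: le_trans (_ : Num.max 0 (M / mu) <= _).
  by rewrite le_max lexx orbT.
have := truncnS_gt (Num.max 0 (M / mu)) => /ltW /le_trans; apply.
by rewrite ler_nat.
Qed.

Lemma val_coef0_unit f g : f * g = 1 -> v (\val (tate_series f 0%MM)) = 0%E.
Proof.
move=> /(congr1 (fun h : T => v (\val (tate_series h 0%MM)))).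
rewrite tate_coef0M tate_coef1 eqxx -[v _ in LHS]/(v (_ * _)) Defs.valM.
rewrite [v _ in RHS](_ : _ = 0%E); last exact: Defs.val1.
move=> /eqP; rewrite padde_eq0 ?val_valring_ge0 // => /andP[/eqP -> _] //.
Qed.

(** Each factor without constant term raises the lowest degree by at least 1; this makes the
    geometric series finite in every coefficient. *)
Lemma coef_exp_lt f k D : tate_series f 0%MM = 0 -> (mdeg D < k)%N ->
  tate_series (f ^+ k) D = 0.
Proof.
move=> f0; elim: k D => // k IHk D Dk.
rewrite exprS tate_coefM big1 // => j jD.
have [->|j0] := eqVneq (j : 'X_{1..n}) 0%MM; first by rewrite f0 mul0r.
rewrite IHk ?mulr0 //; rewrite -mdeg_eq0 -lt0n in j0.
have := congr1 (@mdeg n) (submK jD); rewrite mdegD => jDE.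
by move: Dk; rewrite ltnS => Dk; lia.
Qed.

(* The inverse of [f0 (1 - h)] is computed coefficientwise from the finite
   truncations of [f0^-1 (1 + h + h^2 + ...)], which needs no completeness. *)
Lemma WV_inv alpha f : (forall i, 0 < alpha 0 i) -> WV alpha 0 0 f ->
  v (\val (tate_series f 0%MM)) = 0%E -> exists2 g, WV alpha 0 0 g & f * g = 1.
Proof.
move=> alpha0 Wf vf0; pose f0 : F := \val (tate_series f 0%MM).
have f0N0 : f0 != 0 by rewrite -(val_eq0 v) vf0.
have vV : v f0^-1 = 0%E.
  have := Defs.valM v f0 f0^-1.
  by rewrite mulfV // Defs.val1 vf0 add0e.
have f0VR : f0^-1 \in valring_pred v by rewrite unfold_in vV.
pose u : R := Valring f0VR.
have uf0 : u * tate_series f 0%MM = 1.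
  by apply: val_inj; rewrite -[LHS]/(f0^-1 * f0) mulVf.
pose c : T := tate_of_poly u%:MP.
have c0 : tate_series c 0%MM = u by rewrite /= mcoeffC eqxx mulr1.
have Wc : WV alpha 0 0 c.
  move=> D; rewrite -[tate_series c D]/(u%:MP@_D) mcoeffC; have [<-|_] := eqVneq 0%MM D.
    by rewrite mulr1 wt0 subr0 vV.
  by rewrite mulr0 rmorph0 val0 !leey.
pose h : T := 1 - c * f.
have h0 : tate_series h 0%MM = 0.
  rewrite /h tate_coefD -[tate_series (- _) _]/(- tate_series (c * f) _).
  by rewrite tate_coef0M c0 uf0 tate_coef1 eqxx subrr.
have Wh : WV alpha 0 0 h.
  by apply: WVD; [exact: WV1|apply: WVN; exact: WVMl].
pose S k : T := c * \sum_(i < k) h ^+ i.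
have WS k : WV alpha 0 0 (S k).
  apply: WVMl => //; apply: WV_sum => i _; elim: (val i) => [|j IHj].
    exact: WV1.
  by rewrite exprS; exact: WVMl.
have fS k : f * S k = 1 - h ^+ k.
  have cf : c * f = 1 - h by rewrite /h subKr.
  by rewrite mulrA [f * c]mulrC cf -[RHS]opprB subrX1 -mulNr [- (h - 1)]opprB.
(* The power [h ^+ k] has no terms of degree below k, so the coefficient at D is settled after |D| +
   1 summands. *)
have S_stable k D : (mdeg D < k)%N ->
    tate_series (S k) D = tate_series (S (mdeg D).+1) D.
  elim: k => // k IHk; rewrite ltnS leq_eqVlt => /orP[/eqP -> //|Dk].
  rewrite -IHk // /S big_ord_recr mulrDr tate_coefD [X in _ + X](_ : _ = 0) ?addr0 //.
  rewrite tate_coefM big1 // => j jD; rewrite coef_exp_lt ?mulr0 //.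
  exact: leq_ltn_trans (mdegB _ _) Dk.
pose g : mpseries n R := fun D => tate_series (S (mdeg D).+1) D.
have Wg D : ((wt alpha D)%:E <= v (\val (g D)))%E.
  by have [] := WS (mdeg D).+1 D; rewrite subr0.
exists (Tate (restricted_decay alpha0 Wg)) => [D|].
  by rewrite subr0; split; [exact: Wg|exact: val_valring_ge0].
apply: val_inj; apply: funext => D.
(* The coefficient at D of the product only involves indices <= D, where g agrees with this
   truncation. *)
transitivity (tate_series (f * S (mdeg D).+1) D).
  rewrite -[LHS]/(tate_series (f * _) D) !tate_coefM; apply: eq_bigr => j jD /=.
  by rewrite /g -(S_stable (mdeg D).+1) // ltnS mdegB.
rewrite fS tate_coefD -[tate_series (- _) _]/(- tate_series (h ^+ _) _).
by rewrite coef_exp_lt // subr0.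
Qed.

(** The condition on the constant coefficient does not involve alpha, so being a unit survives the
    passage to alpha' once membership in W(alpha', 0) is known. *)
Lemma W_unitsP alpha f : (forall i, 0 < alpha 0 i) ->
  W_units alpha f <-> WV alpha 0 0 f /\ v (\val (tate_series f 0%MM)) = 0%E.
Proof.
move=> alpha0; have W0E g : W alpha 0 g <-> WV alpha 0 0 g by rewrite W_WV dotp0.
split=> [[/W0E Wf [g _ fg]]|[Wf vf0]]; first by split; last exact: val_coef0_unit fg.
have [g Wg fg] := WV_inv alpha0 Wf vf0.
by split; [exact/W0E|exists g => //; exact/W0E].
Qed.

End Rescaling.

(** * Taylor expansion of a multivariate polynomial in one auxiliary variable *)

Section Taylor.
Context (A B : comNzRingType) (f : {rmorphism A -> B}) (m : nat).
Implicit Types (z e : 'I_m -> B) (P Q : {mpoly A[m]}).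

(** The coefficient of X^k is the whole Taylor term of order k in e, obtained without divided
    derivatives. *)
Definition taylor z e P : {poly B} :=
  mmap (polyC \o f) (fun i => (z i)%:P + e i *: 'X) P.

Lemma horner_taylor z e (x : B) P :
  (taylor z e P).[x] = mmap f (fun i => z i + e i * x) P.
Proof.
rewrite /taylor /mmap -horner_evalE rmorph_sum; apply: eq_bigr => J _.
rewrite rmorphM /mmap1 rmorph_prod /= /horner_eval hornerC; congr (_ * _).
apply: eq_bigr => i _.
by rewrite -!/(horner_eval x _) rmorphXn /= /horner_eval !hornerE.
Qed.

Lemma taylor_coef0 z e P : (taylor z e P)`_0 = mmap f z P.
Proof.
rewrite -horner_coef0 horner_taylor; congr (mmap _ _ _); apply: funext => i.
by rewrite mulr0 addr0.
Qed.

Lemma taylor_horner1 z e P : (taylor z e P).[1] = mmap f (fun i => z i + e i) P.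
Proof.
by rewrite horner_taylor; congr (mmap _ _ _); apply: funext => i; rewrite mulr1.
Qed.

Lemma taylor_coef1 z e P :
  (taylor z e P)`_1 = \sum_j mmap f z P^`M(j) * e j.
Proof.
(* Both sides are additive and obey the Leibniz rule, so checking constants and variables
   suffices. *)
pose chain P := (taylor z e P)`_1 = \sum_j mmap f z P^`M(j) * e j.
have chainC a : chain a%:MP.
  rewrite /chain /taylor mmapC /= coefC big1 // => j _.
  by rewrite mderivC rmorph0 mul0r.
have chainX i : chain 'X_i.
  rewrite /chain /taylor mmapX mmap1U coefD coefC coefZ coefX mulr1 add0r.
  rewrite (bigD1 i) //= big1 => [|j ji]; rewrite mderivX mnmE.
    by rewrite eqxx scale1r -{1}[U_(i)%MM]add0m addmK mpolyX0 rmorph1 mul1r addr0.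
  by rewrite eq_sym (negbTE ji) scale0r rmorph0 mul0r.
have chainD P1 P2 : chain P1 -> chain P2 -> chain (P1 + P2).
  rewrite /chain /taylor rmorphD coefD => -> ->; apply/esym.
  under eq_bigr do rewrite mderivD rmorphD mulrDl.
  exact: big_split.
have chainM P1 P2 : chain P1 -> chain P2 -> chain (P1 * P2).
  rewrite /chain {3}/taylor rmorphM -!/(taylor z e _) coefM.
  rewrite !big_ord_recl big_ord0 addr0 /= !taylor_coef0 => -> ->.
  apply/esym.
  under eq_bigr do rewrite mderivM rmorphD !rmorphM /= mulrDl mulrAC -[X in _ + X]mulrA.
  by rewrite big_split /= -mulr_suml -mulr_sumr addrC.
have chain1 : chain 1 by rewrite -mpolyC1.
suff: chain P by [].
elim/mpolyind: P => [|a J P _ _ cP]; first by rewrite -mpolyC0.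
apply: (chainD) => //; rewrite -mul_mpolyC; apply: (chainM) => //.
rewrite mpolyXE_id; elim/big_ind: _ => // i _.
by elim: (J i) => // k cX; rewrite exprS; apply: (chainM).
Qed.

End Taylor.

(** * Bounds graded by the order in the increment *)

Section Graded.
Context (RR : realType) (F : fieldType) (v : valuation RR F) (n m : nat).
Local Notation T := (tate v n).
Context (alpha : 'rV[RR]_n) (s s' t t' : RR).

(** Models a form of degree l: the X^k coefficient behaves like a product of l - k factors bounded
    by (s, t) and k factors bounded by (s', t'). *)
Definition graded (l : nat) (q : {poly T}) : Prop := forall k,
  ((k <= l)%N -> WV alpha ((l%:R - k%:R) * s + k%:R * s')
                          ((l%:R - k%:R) * t + k%:R * t') q`_k) /\
  ((l < k)%N -> q`_k = 0).

Lemma graded1 : graded 0 1.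
Proof.
move=> k; rewrite coef1; split=> [|/lt0n_neq0/negbTE -> //].
by rewrite leqn0 => /eqP ->; rewrite subrr !mul0r !addr0; exact: WV1.
Qed.

Lemma gradedM l l' q q' : graded l q -> graded l' q' -> graded (l + l') (q * q').
Proof.
move=> gq gq' k; rewrite coefM; split=> lk; last first.
  apply: big1 => i _; have [il|li] := leqP i l; last by rewrite (gq i).2 ?mul0r.
  by rewrite (gq' (k - i)%N).2 ?mulr0 //; lia.
apply: WV_sum => i _; have [il|li] := leqP i l; last first.
  by rewrite (gq i).2 // mul0r; exact: WV0.
have [il'|li'] := leqP (k - i) l'; last first.
  by rewrite (gq' (k - i)%N).2 // mulr0; exact: WV0.
have := WVM ((gq i).1 il) ((gq' (k - i)%N).1 il').
rewrite natrD natrB -1?ltnS //; set ki := (nat_of_ord i)%:R.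
by congr WV; ring.
Qed.

Lemma graded_lin z e : WV alpha s t z -> WV alpha s' t' e ->
  graded 1 (z%:P + e *: 'X).
Proof.
move=> Wz We [|[|k]]; rewrite coefD coefC coefZ coefX /=; split=> // _.
- by rewrite subr0 !mul1r !mul0r !addr0 mulr0 addr0.
- by rewrite subrr !mul1r !mul0r !add0r mulr1.
- by rewrite mulr0 addr0.
Qed.

Lemma graded_mmap1 (h : 'I_m -> {poly T}) (J : 'X_{1..m}) :
  (forall i, graded 1 (h i)) -> graded (mdeg J) (mmap1 h J).
Proof.
move=> gh; rewrite mdegE /mmap1.
apply: (big_ind2 graded) => [|l q l' q'|i _]; [exact: graded1|exact: gradedM|].
elim: (J i) => [|k IHk]; first exact: graded1.
by rewrite exprS -add1n; exact: gradedM.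
Qed.

End Graded.

(** Units are removed from J one at a time. This turns the maxima over K into inequalities depending
    only on |K|. *)
Lemma submultinom_mdeg m (J : 'X_{1..m}) k : (k <= mdeg J)%N ->
  exists2 K : 'X_{1..m}, (K <= J)%MM & mdeg K = k.
Proof.
move: {2}(mdeg J - k)%N (erefl (mdeg J - k)%N) => d; elim: d k => [|d IHd] k dE kJ.
  by exists J; [exact: lepm_refl|lia].
have [||K KJ Kk] := IHd k.+1; [lia|lia|].
have [i Ki] : exists i, (0 < K i)%N.
  apply/existsP; apply: contra_eqT Kk; rewrite negb_exists => /forallP K0.
  by rewrite mdegE big1 // => i _; apply/eqP; rewrite -leqn0 leqNgt K0.
have UK : (U_(i) <= K)%MM by rewrite lep1mP -lt0n.
exists (K - U_(i))%MM; first exact: lepm_trans (lem_subr _ _) KJ.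
by have := congr1 (@mdeg m) (submK UK); rewrite mdegD mdeg1 Kk addn1 => -[].
Qed.

(** * Inequalities encoded in lambda and gamma' *)

Section NewtonConstants.
Context (RR : realType) (n m N : nat) (delta : 'I_m -> 'X_{1..m} -> 'rV[RR]_n).
Context (alpha beta gamma : 'rV[RR]_n) (b c : RR).
Hypotheses (b_gt0 : 0 < b) (c_gt0 : 0 < c).
Local Notation d := (NewtonData alpha beta gamma b c).
Local Notation ht := (dotp (vinv alpha)).
Local Notation lambda := (newton_lambda N delta d).

Lemma newton_lambda_ge0 : 0 <= lambda.
Proof. exact: bigmax_ge_id. Qed.

(** Some j has J_j > 0, and some K <= J^(j) has degree k; the term of (i, j, J, K) in the maximum
    has a positive denominator, which is cleared. *)
Lemma newton_lambda_ub i (J : 'X_{1..m}) k :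
  (2 <= mdeg J <= N)%N -> (0 < k < mdeg J)%N ->
  ht (delta i J) + ((mdeg J)%:R - k%:R - 1) * ht beta + k%:R * ht gamma
    <= lambda * (((mdeg J)%:R - k%:R - 1) * b + k%:R * c).
Proof.
move=> /andP[J2 JN] /andP[k0 kJ].
have [j Jj] : exists j, (0 < J j)%N.
  apply/existsP; apply: contraLR J2; rewrite negb_exists => /forallP J0.
  by rewrite mdegE big1 // => i' _; apply/eqP; rewrite -leqn0 leqNgt J0.
have UJ : (U_(j) <= J)%MM by rewrite lep1mP -lt0n.
have JUd : mdeg (J - U_(j))%MM = (mdeg J).-1.
  by have := congr1 (@mdeg m) (submK UJ); rewrite mdegD mdeg1 addn1 => <-.
have [|K KJ Kk] := @submultinom_mdeg m (J - U_(j))%MM k; first by rewrite JUd; lia.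
have dJ : (mdeg J < N.+1)%N by [].
have dK : (mdeg K < N.+1)%N by rewrite Kk; lia.
have den : 0 < ((mdeg J)%:R - k%:R - 1) * b + k%:R * c.
  rewrite ltr_wpDl ?mulr_gt0 ?ltr0n // mulr_ge0 ?(ltW b_gt0) //.
  by rewrite -addrA -opprD subr_ge0 natr1 ler_nat.
rewrite -ler_pdivrMr // -!dotpZ -!dotpD -Kk.
apply: le_trans (le_bigmax_cond _ _ (isT : xpredT i)).
apply: le_trans (le_bigmax_cond _ _ (isT : xpredT j)).
apply: (@le_bigmax_cond _ _ _ _ (BMultinom dJ, BMultinom dK)) => /=.
by rewrite J2 Jj KJ -mdeg_eq0 Kk -lt0n k0.
Qed.

(** The denominators are nonnegative, so no quotient exceeds the 0 included in the maximum. *)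
Lemma newton_lambda_eq0 :
  (forall i (J : 'X_{1..m}) k, (2 <= mdeg J <= N)%N -> (0 < k < mdeg J)%N ->
    ht (delta i J) + ((mdeg J)%:R - k%:R - 1) * ht beta + k%:R * ht gamma <= 0) ->
  lambda = 0.
Proof.
move=> le0; apply/eqP; rewrite eq_le newton_lambda_ge0 andbT.
apply: bigmax_le => // i _; apply: bigmax_le => // j _; apply: bigmax_le => // -[J K].
case/and4P => /= J2 K0 Jj KJ.
have JN : (mdeg J <= N)%N by rewrite -ltnS; exact: bmdeg.
have UJ : (U_(j) <= J)%MM by rewrite lep1mP -lt0n.
have KJd : (0 < mdeg K < mdeg J)%N.
  rewrite lt0n mdeg_eq0 K0 /=.
  have := congr1 (@mdeg m) (submK UJ); rewrite mdegD mdeg1 addn1 => <-.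
  by rewrite ltnS -(submK KJ) mdegD leq_addl.
have den : 0 <= ((mdeg J)%:R - (mdeg K)%:R - 1) * b + (mdeg K)%:R * c.
  rewrite addr_ge0 ?mulr_ge0 ?(ltW b_gt0) ?(ltW c_gt0) //.
  by rewrite -addrA -opprD subr_ge0 natr1 ler_nat; case/andP: KJd.
rewrite mulr_le0_ge0 ?invr_ge0 // !dotpD !dotpZ.
by apply: le0 => //; rewrite J2.
Qed.

Context (g : RR) (g_max : is_max (newton_gamma_set N delta d) g).

Lemma newton_gamma_ub i (J : 'X_{1..m}) k :
  (mdeg J <= N)%N -> (2 <= k <= mdeg J)%N ->
  ht (delta i J) + ((mdeg J)%:R - k%:R) * ht beta + k%:R * ht gamma
    - lambda * (((mdeg J)%:R - k%:R) * b + k%:R * c) <= g.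
Proof.
move=> JN /andP[k2 kJ]; have [K KJ Kk] := submultinom_mdeg kJ.
case: g_max => _; apply; exists i, J, K; split; rewrite ?Kk //;
  first by rewrite (leq_trans k2 kJ).
by rewrite !dotpD !dotpZ.
Qed.

(* Every term defining [gamma'] is [gamma - lambda c] plus an expression which
   is nonpositive by the choice of [lambda], with [|K| - 1] in place of [|K|]. *)
Lemma newton_gamma_le : g <= ht gamma - lambda * c.
Proof.
case: g_max => -[i [J [K [J2N KJ K2 ->]]]] _; rewrite !dotpD !dotpZ.
have KJd : (mdeg K <= mdeg J)%N by rewrite -(submK KJ) mdegD leq_addl.
have [k Kk] : exists k, mdeg K = k.+1 by exists (mdeg K).-1; rewrite prednK // ltnW.
have k_bounds : (0 < k < mdeg J)%N by lia.
have := newton_lambda_ub i J2N k_bounds.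
rewrite Kk -natr1; lra.
Qed.

End NewtonConstants.

(** * One Newton step and its iteration *)

Section NewtonStep.
Context (RR : realType) (F : fieldType) (v : valuation RR F) (n m : nat).
Local Notation R := (valring v).
Local Notation T := (tate v n).
Local Notation RxS := {mpoly {mpoly R[n]}[m]}.
Implicit Types (z e : 'cV[T]_m) (P : RxS).

Definition tate_of_poly_rmorphism : {rmorphism {mpoly R[n]} -> T} :=
  @tate_of_poly RR F v n.

Local Notation tay z e := (taylor tate_of_poly_rmorphism (fun i => z i 0) (fun i => e i 0)).

Lemma taylor_tate_eval z e P : (tay z e P).[1] = tate_eval (z + e) P.
Proof.
by rewrite taylor_horner1 /tate_eval; congr mmap; apply: funext => i; rewrite mxE.
Qed.

(** The remainder is a sum over the monomials J of P and the orders k >= k0, so it is enough to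
    bound each such contribution. *)
Lemma taylor_remainder alpha s s' t t' alpha' sr tr z e P k0 :
  (forall i, WV alpha s t (z i 0)) -> (forall i, WV alpha s' t' (e i 0)) ->
  (forall J k f, P@_J != 0 -> (k0 <= k <= mdeg J)%N ->
     WV alpha (((mdeg J)%:R - k%:R) * s + k%:R * s')
              (((mdeg J)%:R - k%:R) * t + k%:R * t') f ->
     WV alpha' sr tr (tate_of_poly P@_J * f)) ->
  WV alpha' sr tr (tate_eval (z + e) P - \sum_(k < k0) (tay z e P)`_k).
Proof.
move=> Wz We Wrem; rewrite -taylor_tate_eval.
set q := tay z e P.
(* Padding the length by k0 lets the first k0 terms split off even when q is shorter. *)
rewrite (@horner_coef_wide _ (k0 + size q)) ?leq_addl // big_split_ord /=.
under eq_bigr do rewrite expr1n mulr1.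
under [X in _ + X - _]eq_bigr do rewrite expr1n mulr1.
rewrite addrAC subrr add0r; apply: WV_sum => k' _.
rewrite /q /taylor /mmap coef_sum; set k := (k0 + k')%N.
rewrite big_seq_cond; apply: WV_sum => J; rewrite andbT mcoeff_msupp => PJ.
rewrite /= coefCM.
have gJ : graded alpha s s' t t' (mdeg J)
    (mmap1 (fun i => (z i 0)%:P + e i 0 *: 'X) J).
  by apply: graded_mmap1 => i; exact: graded_lin.
have [kJ|Jk] := leqP k (mdeg J).
  by apply: Wrem (PJ) _ ((gJ k).1 kJ); rewrite leq_addr.
by rewrite (gJ k).2 // mulr0; exact: WV0.
Qed.

(** The linear equation behind the Newton step: it cancels the terms of order 0 and 1 in G(z +
    eps). *)
Lemma Jac_newton_eps (G : 'cV[RxS]_m) z : \det (Jac_at G z) \is a GRing.unit ->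
  Jac_at G z *m newton_eps G z = - G_at G z.
Proof.
by move=> uJ; rewrite /newton_eps mulmxN mulmxA mulmxV ?mul1mx // unitmxE.
Qed.

Lemma W_units_unit alpha (f : T) : W_units alpha f -> f \is a GRing.unit.
Proof. by case=> _ [g _ fg]; apply/asboolP; exists g; rewrite mulrC. Qed.

(** Cramer's rule: the adjugate and the inverse determinant both stay in the ring W(alpha, 0). *)
Lemma WV_invmx alpha k (A : 'M[T]_k) : (forall i j, WV alpha 0 0 (A i j)) ->
  W_units alpha (\det A) -> forall i j, WV alpha 0 0 (invmx A i j).
Proof.
move=> WA UA i j; have uA := W_units_unit UA; have [_ [g Wg Ag]] := UA.
have AV : (\det A)^-1 = g by apply: (mulrI uA); rewrite mulrV.
rewrite /invmx unitmxE uA AV !mxE /cofactor; apply: WVMl.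
  by have := (W_WV _ _ _).1 Wg; rewrite dotp0.
by apply: WVMl; [exact: WV_sign|apply: WV_det => k1 k2; rewrite !mxE].
Qed.

Lemma WV_newton_eps alpha (s t : RR) (G : 'cV[RxS]_m) z :
  (forall i j, WV alpha 0 0 (Jac_at G z i j)) ->
  W_units alpha (\det (Jac_at G z)) ->
  (forall i, WV alpha s t (G_at G z i 0)) ->
  forall i, WV alpha s t (newton_eps G z i 0).
Proof.
move=> WJ UJ WG i; rewrite /newton_eps mxE; apply: WVN; rewrite mxE.
by apply: WV_sum => j _; apply: WVMl; first exact: WV_invmx.
Qed.

(** Otherwise y = x - (x - y) would have positive valuation. *)
Lemma val_eq0_of_close (x y : R) : (0 < v (\val (x - y)%R))%E ->
  v (\val y) = 0%E -> v (\val x) = 0%E.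
Proof.
move=> vxy vy; apply/eqP; rewrite eq_le val_valring_ge0 andbT leNgt.
apply/negP => vx; suff: (0 < v (\val y))%E by rewrite vy ltxx.
have -> : y = x - (x - y) by rewrite subKr.
apply: lt_le_trans (valD v (\val x) (- \val (x - y))).
by rewrite lt_min vx Defs.valN.
Qed.

Context (N : nat) (G : 'cV[RxS]_m) (z : 'cV[T]_m).
Context (delta : 'I_m -> 'X_{1..m} -> 'rV[RR]_n).
Context (alpha beta gamma : 'rV[RR]_n) (b c : RR).
Hypotheses (alpha_gt0 : forall i, 0 < alpha 0 i) (b_gt0 : 0 < b) (c_gt0 : 0 < c).
Hypothesis z_cond : newton_cond G z (NewtonData alpha beta gamma b c).
Hypothesis G_deg : forall i, (msize (G i 0%R) <= N.+1)%N.
Hypothesis G_delta : forall i J, (2 <= mdeg J <= N)%N ->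
  W alpha (delta i J) (tate_of_poly ((G i 0)@_J)).
Context (alpha' beta' gamma' : 'rV[RR]_n) (b' c' : RR).
Hypothesis step : newton_step N delta (NewtonData alpha beta gamma b c)
                                      (NewtonData alpha' beta' gamma' b' c').
Local Notation ht := (dotp (vinv alpha)).
Local Notation lambda := (newton_lambda N delta (NewtonData alpha beta gamma b c)).

Let lambda0 : 0 <= lambda.
Proof. exact: newton_lambda_ge0. Qed.
Let lambda1 : 0 < 1 + lambda.
Proof. by rewrite ltr_pwDl. Qed.
Let alphaE : alpha' = (1 + lambda) *: alpha.
Proof. by case: step => ->; rewrite scalerDl scale1r. Qed.

Lemma dotp_vinv_step x : dotp (vinv alpha') x = (1 + lambda)^-1 * ht x.
Proof. by rewrite alphaE vinvZ dotpZl. Qed.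

(** The products of x with the inverses of alpha and alpha' differ by exactly the factor 1 + lambda
    in [WV_rescale], leaving a condition on alpha alone. *)
Let rescale s t x (f : T) : s - lambda * t <= ht x ->
  WV alpha s t f -> WV alpha' (dotp (vinv alpha') x) t f.
Proof.
move=> le_s Wf; rewrite alphaE; apply: WV_rescale Wf => //.
by rewrite -alphaE dotp_vinv_step mulrA mulfV ?mul1r // lt0r_neq0.
Qed.

Lemma G_mdeg i J : (G i 0)@_J != 0 -> (mdeg J <= N)%N.
Proof.
by rewrite -mcoeff_msupp => /msize_mdeg_lt JG; rewrite -ltnS (leq_trans JG).
Qed.

Lemma newton_step_cond :
  newton_cond G (z + newton_eps G z) (NewtonData alpha' beta' gamma' b' c').
Proof.
have [Wz WG [WJ UJ] gb] := z_cond.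
have [_ betaE gmax b'E c'E] := step.
have {}Wz i : WV alpha (ht beta) b (z i 0) by apply/WVE.
have {}WG i : WV alpha (ht gamma) c (G_at G z i 0) by apply/WVE.
have {}WJ i j : WV alpha 0 0 (Jac_at G z i j) by have /W_WV := WJ i j; rewrite dotp0.
have We := WV_newton_eps WJ UJ WG.
set e := newton_eps G z in We *.
have uJ : \det (Jac_at G z) \is a GRing.unit.
  exact: W_units_unit UJ.
have b'b : b' <= b by rewrite b'E ge_min lexx.
have b'c : b' <= c by rewrite b'E ge_min lexx orbT.
(* The difference consists of the Taylor terms of order >= 1; the choice of lambda puts each of them
   in W(alpha', 0). *)
have WH i j : WV alpha' 0 c (Jac_at G (z + e) i j - Jac_at G z i j).
  have -> : Jac_at G z i j = \sum_(k < 1) (tay z e (Jac G i j))`_k.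
    by rewrite big_ord1 taylor_coef0 mxE.
  rewrite mxE; apply: taylor_remainder Wz We _ => J k f; rewrite mxE.
  rewrite mcoeff_deriv => PJ /andP[k0 kJ] Wf.
  (* The derivative's coefficient at J is J_j + 1 times that of G_i at J + U_j, whose degree |J| + 1
     absorbs the -1 in the formula for lambda. *)
  have GJ : (G i 0)@_(J + U_(j)) != 0 by apply: contra_neq PJ => ->; rewrite mul0rn.
  have JE : mdeg (J + U_(j)) = (mdeg J).+1 by rewrite mdegD mdeg1 addn1.
  have J2 : (2 <= mdeg (J + U_(j))%MM <= N)%N by rewrite (G_mdeg GJ) JE ltnS (leq_trans k0).
  have kJ' : (0 < k < mdeg (J + U_(j))%MM)%N by rewrite JE k0 ltnS.
  have := newton_lambda_ub delta alpha beta gamma b_gt0 c_gt0 i J2 kJ'.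
  have := G_delta i J2 => /W_WV Wd.
  rewrite JE -natr1 => lub.
  rewrite raddfMn /= -mulr_natl -mulrA.
  have := WVM Wd Wf; rewrite add0r => /(WVMl (WV_natr _ _ (J j).+1)) {}Wf.
  rewrite -[X in WV _ X](dotp0 (vinv alpha')).
  apply: WV_le (lexx _) _ (rescale _ Wf); last first.
    by rewrite dotp0; lra.
  (* As k >= 1, the bound (|J| - k) b + k c is at least c. *)
  have bP : 0 <= ((mdeg J)%:R - k%:R) * b by rewrite mulr_ge0 ?subr_ge0 ?ler_nat ?ltW.
  have cP : 0 <= (k%:R - 1) * c by rewrite mulr_ge0 ?subr_ge0 ?ler1n ?ltW.
  by lra.
have WJ' i j : WV alpha' 0 0 (Jac_at G z i j).
  by rewrite -[X in WV _ X](dotp0 (vinv alpha')); apply: rescale (WJ i j);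
    rewrite dotp0 mulr0 subr0.
split.
(* Rescaling gains lambda b for z and lambda c for eps, both at least lambda b'; for eps, gamma <=
   beta is also used. *)
- move=> i; apply/WVE; rewrite mxE; apply: WVD.
    apply: (WV_le (lexx _) b'b (rescale _ (Wz i))).
    by rewrite betaE lerB // ler_wpM2l.
  apply: (WV_le (lexx _) b'c (rescale _ (We i))).
  by rewrite betaE lerB // ler_wpM2l.
- move=> i; apply/WVE.
  (* The subtracted terms of order 0 and 1 add up to the i-th entry of G(z) + Jac_G(z) eps, which is
     0. *)
  have -> : G_at G (z + e) i 0 = tate_eval (z + e) (G i 0) -
      \sum_(k < 2) (tay z e (G i 0))`_k.
    rewrite mxE -[LHS]subr0; congr (_ - _).
    rewrite big_ord_recl big_ord1 taylor_coef0 taylor_coef1 /=.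
    have <- : (Jac_at G z *m e) i 0 = \sum_j tate_eval z (G i 0)^`M(j) * e j 0.
      by rewrite mxE; apply: eq_bigr => j _; rewrite !mxE.
    by rewrite Jac_newton_eps // !mxE subrr.
  apply: taylor_remainder Wz We _ => J k f GJ /andP[k2 kJ] Wf.
  have J2 : (2 <= mdeg J <= N)%N by rewrite (G_mdeg GJ) (leq_trans k2).
  have k2J : (2 <= k <= mdeg J)%N by rewrite k2.
  have gub := newton_gamma_ub gmax i (G_mdeg GJ) k2J.
  have := G_delta i J2 => /W_WV Wd.
  have := WVM Wd Wf; rewrite add0r => {}Wf.
  apply: WV_le (lexx _) _ (rescale _ Wf); last lra.
  (* Only orders k >= 2 remain, which gives the quadratic gain c' = 2c. *)
  have bP : 0 <= ((mdeg J)%:R - k%:R) * b by rewrite mulr_ge0 ?subr_ge0 ?ler_nat ?ltW.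
  have cP : 0 <= (k%:R - 2) * c by rewrite mulr_ge0 ?subr_ge0 ?ler_nat ?ltW.
  by rewrite c'E; lra.
- have alpha'_gt0 i : 0 < alpha' 0 i by rewrite alphaE mxE mulr_gt0.
  have WJz' i j : WV alpha' 0 0 (Jac_at G (z + e) i j).
    rewrite -[Jac_at G (z + e) i j](subrK (Jac_at G z i j)); apply: WVD => //.
    exact: WV_le (lexx _) (ltW c_gt0) (WH i j).
  split; first by move=> i j; apply/W_WV; rewrite dotp0.
  apply/W_unitsP => //; split; first exact: WV_det.
  (* The two determinants agree modulo V(c) with c > 0, so the constant coefficient keeps valuation
     0. *)
  have VdJ : V c (\det (Jac_at G (z + e)) - \det (Jac_at G z)).
    by apply: det_V => i j D; have [] := WH i j D.
  have vdJ := ((W_unitsP _ alpha_gt0).1 UJ).2.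
  apply: val_eq0_of_close vdJ; apply: lt_le_trans (VdJ 0%MM); first by rewrite lte_fin.
(* Condition (4): after pairing with the inverse of alpha, gamma' <= gamma - lambda c <= beta -
   lambda b'. *)
rewrite !dotp_vinv_step ler_wpM2l ?invr_ge0 ?(ltW lambda1) //.
apply: le_trans (newton_gamma_le b_gt0 c_gt0 gmax) _.
by rewrite betaE lerB // ler_wpM2l.
Qed.

(* Both [beta'] and [gamma'] have dropped by [lambda] times the corresponding
   bound, which makes every expression under the next maximum nonpositive; and
   [gamma] only decreases from then on. *)
Lemma newton_iter_stable : b' = b ->
  forall d : nat -> newton_data RR n,
    d 0%N = NewtonData alpha' beta' gamma' b' c' ->
    (forall k, newton_step N delta (d k) (d k.+1)) ->
    forall k,
      [/\ nd_alpha (d k) = alpha',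
          dotp (vinv alpha') (nd_beta (d k)) = dotp (vinv alpha') beta'
        & nd_b (d k) = b'].
Proof.
move=> b'b d d0 dS k; have [_ betaE gmax b'E c'E] := step.
have b'c : b' <= c by rewrite b'E ge_min lexx orbT.
have b'c' : b' <= c' by rewrite c'E (le_trans b'c) // ler_peMl ?ler1n // ltW.
(* The induction also carries b' <= c, so that the minimum of b' and c stays b', and that the
   current gamma does not exceed gamma'. *)
suff: [/\ nd_alpha (d k) = alpha',
          dotp (vinv alpha') (nd_beta (d k)) = dotp (vinv alpha') beta',
          nd_b (d k) = b', b' <= nd_c (d k)
        & dotp (vinv alpha') (nd_gamma (d k)) <= dotp (vinv alpha') gamma'].
  by case.
elim: k => [|k]; first by rewrite d0; split.
move: (dS k); case: (d k) (d k.+1) => [a1 be1 ga1 b1 c1] [a2 be2 ga2 b2 c2].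
move=> step2 [a1E be1E b1E b'c1 ga1le].
rewrite /nd_alpha /nd_beta /nd_gamma /nd_b /nd_c in a1E be1E b1E b'c1 ga1le *.
case: step2; rewrite {}a1E {}b1E be1E.
have b'0 : 0 < b' by rewrite b'b.
have c10 : 0 < c1 := lt_le_trans b'0 b'c1.
have lam0 : newton_lambda N delta (NewtonData alpha' be1 ga1 b' c1) = 0.
  apply: newton_lambda_eq0 => // i J j J2 jJ; rewrite be1E.
  have lub := newton_lambda_ub delta alpha beta gamma b_gt0 c_gt0 i J2 jJ.
  have gle := newton_gamma_le b_gt0 c_gt0 gmax.
  apply: le_trans (_ : dotp (vinv alpha') (delta i J) + ((mdeg J)%:R - j%:R - 1) *
    dotp (vinv alpha') beta' + j%:R * dotp (vinv alpha') gamma' <= 0).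
    by rewrite lerD2l ler_wpM2l.
  (* Multiplied by 1 + lambda, this follows from the bound defining the first lambda: beta dropped
     by lambda b and gamma by at least lambda c. *)
  rewrite !dotp_vinv_step betaE b'b.
  rewrite [_ * (_^-1 * _)]mulrCA [j%:R * _]mulrCA -!mulrDr pmulr_rle0 ?invr_gt0 //.
  have : j%:R * ht gamma' <= j%:R * (ht gamma - lambda * c) by rewrite ler_wpM2l.
  lra.
rewrite lam0 scale0r addr0 mul0r subr0 => -> -> gmax2 -> ->; split=> //.
- exact/min_idPl.
- by rewrite (le_trans b'c1) // ler_peMl ?ler1n // ltW.
(* With lambda = 0, [newton_gamma_le] says that gamma does not increase. *)
apply: le_trans ga1le.
by have := newton_gamma_le b'0 c10 gmax2; rewrite lam0 mul0r subr0.
Qed.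

End NewtonStep.

Theorem proposition4p14
    (RR : realType) (p : nat) (hp : prime p)
    (Qp : fieldType) (vp : valuation RR Qp) (hQp : is_padic_field p vp)
    (K : fieldExtType Qp) (v : valuation RR K)
    (hv : forall a : Qp, v a%:A = vp a)
    (n r : nat) (hr : (r < n)%N)
    (G : 'cV[{mpoly {mpoly (valring v)[n]}[n - r]}]_(n - r))
    (z : 'cV[tate v n]_(n - r))
    (alpha beta gamma : 'rV[RR]_n) (b c : RR)
    (halpha : forall i, 0 < alpha 0 i) (hb : 0 < b) (hc : 0 < c)
    (hz : newton_cond G z (NewtonData alpha beta gamma b c))
    (N : nat) (hN : (2 <= N)%N)
    (hdeg : forall i, (msize (G i 0%R) <= N.+1)%N)
    (delta : 'I_(n - r) -> 'X_{1..n - r} -> 'rV[RR]_n)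
    (hdelta : forall i J, (2 <= mdeg J <= N)%N ->
       W alpha (delta i J) (tate_of_poly ((G i 0)@_J)))
    (alpha' beta' gamma' : 'rV[RR]_n) (b' c' : RR)
    (hstep : newton_step N delta (NewtonData alpha beta gamma b c)
                                 (NewtonData alpha' beta' gamma' b' c')) :
  newton_cond G (z + newton_eps G z) (NewtonData alpha' beta' gamma' b' c') /\
  (b' = b ->
   forall d : nat -> newton_data RR n,
     d 0%N = NewtonData alpha' beta' gamma' b' c' ->
     (forall k, newton_step N delta (d k) (d k.+1)) ->
     forall k,
       [/\ nd_alpha (d k) = alpha',
           dotp (vinv alpha') (nd_beta (d k)) = dotp (vinv alpha') beta'
         & nd_b (d k) = b']).
Proof.
split; last exact: newton_iter_stable hstep.
exact: newton_step_cond hz hdeg hdelta _ _ _ _ _ hstep.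
Qed.
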